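(* Let $0<\alpha<1$, $c_m>c_r>0$, $\Delta=c_m-c_r$ and $s>0$. In the manufacturer-led Stackelberg game of the manufacturer-led recycling model (Model M) there exists a unique equilibrium $(p_m^{M*},w^{M*},b_m^{M*},p_r^{M*})$, where $p_m^{M*}$ is the unit selling price of new items in the manufacturer's direct channel, $w^{M*}$ the unit wholesale price, $b_m^{M*}$ the unit recycling subsidy for used items, and $p_r^{M*}$ the unit selling price in the retailer's indirect channel.
   Context: Parameters: $\alpha$ is the primary customers' preference for the direct channel, $c_m$ and $c_r$ are the unit costs of manufacturing and remanufacturing, $\Delta=c_m-c_r>0$ is the unit cost saving, $s>0$ is a unit government subsidy. Model M. The demands, as functions of real decision variables $p_m,w,b_m,p_r$, are $$q_1=\frac{\alpha p_r-p_m}{\alpha(1-\alpha)},\qquad q_2=1-\frac{p_r-p_m}{1-\alpha},\qquad q_3=b_m .$$ The manufacturer's profit is $$\Pi_m=(p_m-c_m)q_1+(w-c_m)q_2+(\Delta+s+p_m-c_m-b_m)q_3,$$ and the retailer's profit is $\Pi_r=(p_r-w)q_2$. Stackelberg game: the manufacturer (leader) first chooses $(p_m,w,b_m)$; then the retailer (follower), knowing these values, chooses $p_r$ to maximize $\Pi_r$. An equilibrium (by backward induction) consists of a leader choice $(p_m^{M*},w^{M*},b_m^{M*})$ maximizing $\Pi_m$ when $p_r$ is replaced by the retailer's best response to the leader's choice, together with $p_r^{M*}$, the retailer's best response to $(p_m^{M*},w^{M*},b_m^{M*})$. *)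

(* Defs.v *)
From Stdlib Require Import Reals.
Open Scope R_scope.

Record leader_choice := LeaderChoice { p_m : R; w : R; b_m : R }.

Record outcome := Outcome { leader : leader_choice; p_r : R }.

(* In the functions below, x is the leader's choice and p the retail price. *)

Definition q1 (alpha : R) (x : leader_choice) (p : R) : R :=
  (alpha * p - p_m x) / (alpha * (1 - alpha)).

Definition q2 (alpha : R) (x : leader_choice) (p : R) : R :=
  1 - (p - p_m x) / (1 - alpha).

Definition q3 (x : leader_choice) : R := b_m x.

Definition Pi_m (alpha c_m Delta s : R) (x : leader_choice) (p : R) : R :=
  (p_m x - c_m) * q1 alpha x p
  + (w x - c_m) * q2 alpha x p
  + (Delta + s + p_m x - c_m - b_m x) * q3 x.

Definition Pi_r (alpha : R) (x : leader_choice) (p : R) : R :=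
  (p - w x) * q2 alpha x p.

Definition best_response (alpha : R) (x : leader_choice) (p : R) : Prop :=
  forall p' : R, Pi_r alpha x p' <= Pi_r alpha x p.

(* The equivalence makes rho x the only best response to x, for every x, so
   that the game needs no tie-breaking rule and no leader choice is left
   without a reply. *)
Definition reaction_function (alpha : R) (rho : leader_choice -> R) : Prop :=
  forall (x : leader_choice) (p : R), best_response alpha x p <-> p = rho x.

Definition stackelberg_equilibrium (alpha c_m Delta s : R) (e : outcome) : Prop :=
  exists rho : leader_choice -> R,
    reaction_function alpha rho /\
    (forall x : leader_choice,
       Pi_m alpha c_m Delta s x (rho x)
       <= Pi_m alpha c_m Delta s (leader e) (rho (leader e))) /\
    p_r e = rho (leader e).

(* Main.v *)
(* Completing the square in p_r shows that the retailer's only best response is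
   the midpoint of w and p_m + 1 - alpha.  After substituting it, the
   manufacturer's profit is a constant minus three squares, in w - p_m,
   in b_m - (p_m + const) / 2 and in p_m.  The last one has coefficient
   1 / alpha - 1 / 4, which is positive because alpha < 4, so the maximizer
   exists and is unique. *)

Require Import Defs.
From Stdlib Require Import Reals Lra.
Open Scope R_scope.

Definition reply (alpha : R) (x : leader_choice) : R :=
  (w x + p_m x + (1 - alpha)) / 2.

(** The stationary point in [p_m] of the manufacturer's profit once [p_r], [w] and [b_m] are
    replaced by their optimal values for given [p_m]. *)
Definition optimal_p_m (alpha c_m Delta s : R) : R :=
  c_m + (2 * alpha - 2 * c_m + alpha * (Delta + s)) / (4 - alpha).

Definition optimal_choice (alpha c_m Delta s : R) : leader_choice :=
  let p := optimal_p_m alpha c_m Delta s in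
  LeaderChoice p (p + (1 - alpha) / 2) ((Delta + s + p - c_m) / 2).

Lemma sqr_eq0 (y : R) : y ^ 2 = 0 -> y = 0.
Proof. intro H; apply Rsqr_0_uniq; unfold Rsqr; lra. Qed.

Lemma weighted_sqr_ge0 (a y : R) : 0 < a -> 0 <= a * y ^ 2.
Proof. intro Ha; apply Rmult_le_pos; [lra | apply pow2_ge_0]. Qed.

Lemma weighted_sqr_le0 (a y : R) : 0 < a -> a * y ^ 2 <= 0 -> y = 0.
Proof.
  intros Ha H; apply sqr_eq0.
  pose proof (weighted_sqr_ge0 a y Ha).
  destruct (Rmult_integral a (y ^ 2)); lra.
Qed.

Lemma Pi_r_square (alpha : R) (x : leader_choice) (p : R) :
  alpha < 1 ->
  Pi_r alpha x p =
    Pi_r alpha x (reply alpha x) - / (1 - alpha) * (p - reply alpha x) ^ 2.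
Proof. intro H; unfold Pi_r, q2, reply; field; lra. Qed.

Lemma reaction_function_reply (alpha : R) :
  alpha < 1 -> reaction_function alpha (reply alpha).
Proof.
  intros H x p.
  assert (Hk : 0 < / (1 - alpha)) by (apply Rinv_0_lt_compat; lra).
  split.
  (* Testing [p] against the vertex of the parabola leaves a nonpositive weighted square. *)
  - intro Hp; specialize (Hp (reply alpha x)).
    rewrite (Pi_r_square alpha x p H) in Hp.
    apply Rminus_diag_uniq, (weighted_sqr_le0 _ _ Hk); lra.
  - intros -> p'; rewrite (Pi_r_square alpha x p' H).
    pose proof (weighted_sqr_ge0 _ (p' - reply alpha x) Hk); lra.
Qed.

(** An equilibrium carries its own [rho]; pointwise agreement lets any such [rho] be traded for
    [reply]. *)
Lemma reaction_function_unique (alpha : R) (rho rho' : leader_choice -> R) :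
  reaction_function alpha rho -> reaction_function alpha rho' ->
  forall x, rho x = rho' x.
Proof. intros H H' x; apply (H' x), (H x); reflexivity. Qed.

(** The squares are completed in [w] and [b_m] with [p_m] fixed, and only then in [p_m], so the
    system of their zeros is triangular. The factor [1] gives all three terms the shape that the
    weighted square lemmas expect. *)
Lemma Pi_m_reply_squares (alpha c_m Delta s : R) (x : leader_choice) :
  0 < alpha -> alpha < 1 ->
  let y := optimal_choice alpha c_m Delta s in
  Pi_m alpha c_m Delta s x (reply alpha x) =
    Pi_m alpha c_m Delta s y (reply alpha y)
    - (/ (2 * (1 - alpha)) * (w x - p_m x - (1 - alpha) / 2) ^ 2
       + 1 * (b_m x - (Delta + s + p_m x - c_m) / 2) ^ 2
       + (4 - alpha) / (4 * alpha) * (p_m x - p_m y) ^ 2).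
Proof.
  intros H0 H1; cbv zeta.
  unfold Pi_m, q1, q2, q3, reply, optimal_choice, optimal_p_m; simpl p_m;
    simpl w; simpl b_m.
  field; lra.
Qed.

Lemma Pi_m_reply_max (alpha c_m Delta s : R) (x : leader_choice) :
  0 < alpha -> alpha < 1 ->
  let y := optimal_choice alpha c_m Delta s in
  Pi_m alpha c_m Delta s x (reply alpha x)
    <= Pi_m alpha c_m Delta s y (reply alpha y) /\
  (Pi_m alpha c_m Delta s y (reply alpha y)
     <= Pi_m alpha c_m Delta s x (reply alpha x) -> x = y).
Proof.
  intros H0 H1 y.
  assert (Hk : 0 < / (2 * (1 - alpha))) by (apply Rinv_0_lt_compat; lra).
  assert (Ha : 0 < (4 - alpha) / (4 * alpha)) by (apply Rdiv_lt_0_compat; lra).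
  pose proof (Pi_m_reply_squares alpha c_m Delta s x H0 H1) as E.
  cbv zeta in E; fold y in E.
  pose proof (weighted_sqr_ge0 _ (w x - p_m x - (1 - alpha) / 2) Hk) as Sw.
  pose proof (weighted_sqr_ge0 1 (b_m x - (Delta + s + p_m x - c_m) / 2)
                Rlt_0_1) as Sb.
  pose proof (weighted_sqr_ge0 _ (p_m x - p_m y) Ha) as Sp.
  split; [lra | intro Hle].
  (* The three nonnegative terms have sum at most 0, so each vanishes. *)
  assert (Ew : w x - p_m x - (1 - alpha) / 2 = 0)
    by (apply (weighted_sqr_le0 _ _ Hk); lra).
  assert (Eb : b_m x - (Delta + s + p_m x - c_m) / 2 = 0)
    by (apply (weighted_sqr_le0 _ _ Rlt_0_1); lra).
  assert (Ep : p_m x - p_m y = 0) by (apply (weighted_sqr_le0 _ _ Ha); lra).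
  clear - Ew Eb Ep.
  destruct x as [p v b]; unfold y, optimal_choice in *; simpl in *.
  f_equal; lra.
Qed.

Theorem theorem1 (alpha c_m c_r Delta s : R)
    (halpha0 : 0 < alpha) (halpha1 : alpha < 1)
    (hcr : 0 < c_r) (hcm : c_r < c_m)
    (hDelta : Delta = c_m - c_r) (hs : 0 < s) :
  exists! e : outcome, stackelberg_equilibrium alpha c_m Delta s e.
Proof.
  set (y := optimal_choice alpha c_m Delta s).
  pose proof (reaction_function_reply alpha halpha1) as Hreply.
  exists (Outcome y (reply alpha y)); split.
  - exists (reply alpha); split; [exact Hreply | split; [| reflexivity]].
    intro x; apply Pi_m_reply_max; assumption.
  - intros [x p] [rho [Hrho [Hmax Hp]]]; simpl in *.
    pose proof (reaction_function_unique alpha _ _ Hrho Hreply) as Erho.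
    (* The rival leader choice [x] does at least as well as [y]; with [rho] turned into [reply],
       this is the equality case of [Pi_m_reply_max]. *)
    specialize (Hmax y); rewrite !Erho in Hmax; rewrite Erho in Hp.
    assert (Hxy : x = y) by (apply Pi_m_reply_max; assumption).
    subst x p; reflexivity.
Qed.
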